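(* Every real $3\times N$ unit norm frame has worst-case coherence $\mu\ge1-\frac4N+\frac2{N^2}$.
   Context: A real $3\times N$ unit norm frame is a real $3\times N$ matrix $\Phi=[\varphi_1\cdots\varphi_N]$ of rank $3$ (so $N\ge3$) with unit-norm columns. Its worst-case coherence is $\mu:=\max_{i\ne j}|\langle\varphi_i,\varphi_j\rangle|$. *)

(* Defs.v *)
From mathcomp Require Import all_boot all_order all_algebra.
From mathcomp Require Import reals.

Set Implicit Arguments.
Unset Strict Implicit.
Unset Printing Implicit Defensive.

Import Order.TTheory GRing.Theory Num.Theory.

Local Open Scope ring_scope.

Definition dotcv (R : realType) (m : nat) (u v : 'cV[R]_m) : R :=
  \sum_(k < m) u k 0 * v k 0.

(* The Euclidean norm; MathComp-Analysis' canonical norm on matrices is the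
   sup norm. *)
Definition enorm (R : realType) (m : nat) (u : 'cV[R]_m) : R :=
  Num.sqrt (dotcv u u).

Definition unit_norm_frame (R : realType) (m N : nat) (Phi : 'M[R]_(m, N)) :
    Prop :=
  \rank Phi = m /\ forall j : 'I_N, enorm (col j Phi) = 1.

(* The default value 0 of the iterated maximum is harmless: all the terms are
   nonnegative, so for N >= 2 this is the maximum over the pairs i != j. *)
Definition coherence (R : realType) (m N : nat) (Phi : 'M[R]_(m, N)) : R :=
  \big[Num.max/0]_(p : 'I_N * 'I_N | p.1 != p.2)
    `|dotcv (col p.1 Phi) (col p.2 Phi)|.

(* Main.v *)
From HB Require Import structures.
Require Import Defs.
From mathcomp Require Import all_boot all_order all_algebra.
From mathcomp Require Import boolp reals.
From mathcomp Require Import separable cyclotomic complex polyrcf.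
From mathcomp Require Import zify ring lra.

Import Order.TTheory GRing.Theory Num.Theory.

Local Open Scope ring_scope.

(** The bound is the area bound for packing spherical caps.  Let [mu] be the
coherence, [c ^ 2 = (1 + mu) / 2] with [c > 0], and [phi i] the columns.  If a
unit vector [x] had [|<x, phi i>| > c] and [|<x, phi j>| > c] for some
[i != j], then the signs of these two inner products would select one of
[phi i + phi j] and [phi i - phi j] whose inner product with [x] exceeds
[2 * c] in absolute value, although its squared norm is at most
[2 + 2 * mu = (2 * c) ^ 2], against the Cauchy-Schwarz inequality
([caps_disjoint]).  So the [N] double caps [{x | |<x, phi i>| > c}] are
pairwise disjoint.  By Archimedes' hat-box theorem each of them covers the
proportion [1 - c] of the sphere (if [c <= 1]).  Hence [N * (1 - c) <= 1], that
is [c >= 1 - 1 / N], and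
[mu = 2 * c ^ 2 - 1 >= 2 * (1 - 1 / N) ^ 2 - 1 = 1 - 4 / N + 2 / N ^ 2].

No measure on the sphere is needed for this.  Only functions of the form
[g (<x, u> ^ 2)] with [g] a polynomial are averaged over the sphere, and
such an average can be computed exactly in two stages.
- On the parallel at height [z], the average over the circle may be replaced by
  the average over the vertices of a regular polygon with enough vertices
  ([circle_design]); the result is a polynomial in [z] ([latitude_design]).
- That polynomial is integrated over [0 <= z <= 1] through its formal
  primitive.  The average of [<x, u> ^ (2 * k)] comes out as
  [|u| ^ (2 * k) / (2 * k + 1)], which is [\int_0^1 t ^ (2 * k) dt] for unit [u]
  ([integral01_latitude_mean]): this is the hat-box theorem for even powers.
Both stages preserve inequalities, whence [spherical_mean_le]: if
[\sum_i g (<x, phi i> ^ 2) <= K] on the whole sphere then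
[N * \int_0^1 g (t ^ 2) dt <= K].  Applied to polynomials [g] approximating the
indicator function of [w > c ^ 2] ([step_polynomial]), this gives the packing
bound ([cap_packing]). *)

(** * Averages over regular polygons *)

Lemma prim_root_exists (F : closedFieldType) (n : nat) :
  (0 < n)%N -> n%:R != 0 :> F -> exists z : F, n.-primitive_root z.
Proof.
move=> n_gt0 n_neq0; have [r Dp] := closed_field_poly_normal ('X^n - 1 : {poly F}).
rewrite (monicP _) ?monicXnsubC // scale1r in Dp.
have rn1 : all n.-unity_root r.
  by apply/allP=> z; rewrite -root_prod_XsubC -Dp.
have sz_r : (n < (size r).+1)%N.
  by rewrite -(size_prod_XsubC r id) -Dp size_XnsubC.
have [|z] := hasP (cyclic.has_prim_root n_gt0 rn1 _ sz_r); last by exists z.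
by rewrite -separable_prod_XsubC -Dp separable_Xn_sub_1.
Qed.

(** Off the diagonal this is a full period of the geometric progression of the
root of unity [z ^ (i - j)], which differs from 1. *)
Lemma prim_root_orthogonal {F : fieldType} {n : nat} {z : F} {i j : nat} :
    n.-primitive_root z -> (i < n)%N -> (j < n)%N ->
  \sum_(k < n) (z ^+ k) ^+ i * (z ^- k) ^+ j = n%:R *+ (i == j).
Proof.
move=> zP lti ltj.
have z0 : z != 0 by rewrite (prim_root_eq0 zP) -lt0n (prim_order_gt0 zP).
pose q := z ^+ i / z ^+ j.
have -> : \sum_(k < n) (z ^+ k) ^+ i * (z ^- k) ^+ j = \sum_(k < n) q ^+ k.
  by apply: eq_bigr => k _; rewrite /q exprMn !exprVn -!exprM mulnC (mulnC k j).
have [eq_ij|neq_ij] := eqVneq i j.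
  rewrite /q eq_ij mulfV ?expf_neq0 // (eq_bigr (fun=> 1)) => [|k _]; last exact: expr1n.
  by rewrite sumr_const card_ord.
have q1 : q - 1 != 0.
  rewrite subr_eq0; apply: contra neq_ij => /eqP /divr1_eq /eqP.
  by rewrite (eq_prim_root_expr zP) !modn_small.
apply: (mulfI q1); rewrite -subrX1 mulr0 /q exprMn exprVn -!exprM !(mulnC _ n).
by rewrite !exprM (prim_expr_order zP) !expr1n divr1 subrr.
Qed.

(** The vertices [z ^ k] integrate trigonometric polynomials of degree less than
[n] exactly: in the binomial expansion only the term without a power of
[z ^ k] survives. *)
Lemma sum_prim_root_binomial {F : fieldType} {n m : nat} {z : F} (b c : F) :
    n.-primitive_root z -> (m < n)%N ->
  \sum_(k < n) (b * z ^+ k + c * z ^- k) ^+ m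
    = n%:R * (if odd m then 0 else 'C(m, m./2)%:R * (b * c) ^+ m./2).
Proof.
move=> zP lt_mn.
under eq_bigr => k _ do rewrite exprDn.
rewrite exchange_big /=.
have E (i : 'I_m.+1) :
    \sum_(k < n) (b * z ^+ k) ^+ (m - i) * (c * z ^- k) ^+ i *+ 'C(m, i)
    = (b ^+ (m - i) * c ^+ i *+ 'C(m, i)) * (n%:R *+ (m - i == i)%N).
  have lti : (i < n)%N by rewrite (leq_ltn_trans _ lt_mn) // -ltnS.
  rewrite -(prim_root_orthogonal zP (leq_ltn_trans (leq_subr i m) lt_mn) lti) mulr_sumr.
  apply: eq_bigr => k _; rewrite !exprMn mulrnAl; congr (_ *+ _); ring.
rewrite (eq_bigr _ (fun i _ => E i)) {E}.
case: ifP => oddm.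
  rewrite mulr0 big1 // => i _; rewrite (_ : (_ == _) = false) ?mulr0 //.
  by apply/eqP => H; move: oddm (ltn_ord i); lia.
have hm : (m./2 < m.+1)%N by lia.
rewrite (bigD1 (Ordinal hm)) //= big1 => [|i /eqP ne_i]; last first.
  rewrite (_ : (_ == _) = false) ?mulr0 //; apply/eqP => H; apply: ne_i.
  by apply: val_inj => /=; move: oddm (ltn_ord i); lia.
have -> : (m - m./2 = m./2)%N by lia.
by rewrite eqxx addr0 mulr1n -mulr_natr exprMn; ring.
Qed.

Lemma sum_even_ord {V : zmodType} (k : nat) (f : nat -> V) :
  (forall i, odd i -> f i = 0) ->
  \sum_(i < k.*2.+1) f i = \sum_(m < k.+1) f m.*2.
Proof.
move=> f_odd; elim: k => [|k IHk]; first by rewrite !big_ord1.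
rewrite doubleS 2!big_ord_recr /= IHk (f_odd k.*2.+1) ?addr0;
  last by rewrite /= odd_double.
by rewrite [RHS]big_ord_recr.
Qed.

(** A regular polygon with [2 * d + 1] vertices has the same moments as the
circle up to degree [2 * d].  The factors [C(2m, m) / 4 ^ m] are the means of
[cos ^ (2 * m)]. *)
Lemma circle_design (R : rcfType) (d : nat) :
  exists n (x y : 'I_n -> R), [/\ (0 < n)%N, forall j, x j ^+ 2 + y j ^+ 2 = 1 &
    forall k a b c, (k <= d)%N ->
      \sum_j (a + (b * x j + c * y j)) ^+ k.*2 = n%:R *
        \sum_(m < k.+1) 'C(k.*2, m.*2)%:R * 'C(m.*2, m)%:R / 4 ^+ m
           * a ^+ (k - m).*2 * (b ^+ 2 + c ^+ 2) ^+ m].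
Proof.
pose n := d.*2.+1.
have [z zP] : exists z : R[i], n.-primitive_root z.
  by apply: prim_root_exists; rewrite // pnatr_eq0.
have nz : `|z| = 1.
  by apply/eqP; rewrite -(@pexpr_eq1 _ _ n) // -normrX (prim_expr_order zP) normr1.
have z_conj j : (z ^+ j)^*%C = z ^- j.
  by rewrite invc_norm normrX nz expr1n expr1n invr1 mul1r.
exists n, (fun j => complex.Re (z ^+ j)), (fun j => complex.Im (z ^+ j)); split=> //.
  by move=> j; apply: (@complexI R); rewrite add_Re2_Im2 normrX nz !expr1n.
move=> k a b c le_kd.
pose X j := b * complex.Re (z ^+ j) + c * complex.Im (z ^+ j).
have momX m : (m < n)%N -> \sum_(j < n) X j ^+ m =
    n%:R * (if odd m then 0 else 'C(m, m./2)%:R * ((b ^+ 2 + c ^+ 2) / 4) ^+ m./2).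
  move=> lt_mn; apply: (@complexI R).
  (* With this [B], [X j] is the real trigonometric monomial
     [B * z ^ j + conj (B * z ^ j)]. *)
  pose B : R[i] := Complex (b / 2) (- (c / 2)).
  have XE (j : 'I_n) : ((X j)%:C)%C = B * z ^+ j + (B^*)%C * z ^- j.
    rewrite -z_conj -rmorphM /= addcJ /X; case: (z ^+ j) => u v.
    rewrite mulr_natl mulr2n; apply/eqP; rewrite eq_complex /=.
    by apply/andP; split; apply/eqP; field.
  rewrite raddf_sum /=; under eq_bigr => j _ do rewrite rmorphXn /= XE.
  rewrite (sum_prim_root_binomial _ _ zP lt_mn).
  have BB : B * (B^*)%C = (((b ^+ 2 + c ^+ 2) / 4)%:C)%C.
    by apply/eqP; rewrite eq_complex /=; apply/andP; split; apply/eqP; field => //.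
  rewrite BB [RHS]rmorphM rmorph_nat; case: odd; first by rewrite rmorph0.
  by rewrite [in RHS]rmorphM rmorph_nat rmorphXn.
under eq_bigr => j _ do rewrite exprDn.
rewrite exchange_big /=.
have E (i : 'I_k.*2.+1) : \sum_(j < n) (a ^+ (k.*2 - i) * X j ^+ i) *+ 'C(k.*2, i) =
    a ^+ (k.*2 - i) * 'C(k.*2, i)%:R * (n%:R *
      (if odd i then 0 else 'C(i, i./2)%:R * ((b ^+ 2 + c ^+ 2) / 4) ^+ i./2)).
  rewrite -momX; last by rewrite (leq_trans (ltn_ord i)) // /n ltnS leq_double.
  by rewrite mulr_sumr; apply: eq_bigr => j _; rewrite -mulr_natr; ring.
rewrite (eq_bigr _ (fun i _ => E i)) {E}.
rewrite (sum_even_ord k (fun i => a ^+ (k.*2 - i) * 'C(k.*2, i)%:R * (n%:R *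
      (if odd i then 0 else 'C(i, i./2)%:R * ((b ^+ 2 + c ^+ 2) / 4) ^+ i./2))));
  last by move=> i ->; rewrite !mulr0.
rewrite mulr_sumr; apply: eq_bigr => m _.
by rewrite odd_double doubleK -doubleB expr_div_n; ring.
Qed.

(** * Integration of polynomials over the unit interval *)

(** The coefficient of index 0 is [p`_0 / 0 = 0], so this is the primitive that
vanishes at 0. *)
Definition primitive {R : fieldType} (p : {poly R}) : {poly R} :=
  \poly_(i < (size p).+1) (p`_i.-1 / i%:R).

Definition integral01 {R : fieldType} (p : {poly R}) : R := (primitive p).[1].

Lemma primitive_horner0 {R : fieldType} (p : {poly R}) : (primitive p).[0] = 0.
Proof. by rewrite horner_coef0 coef_poly /= invr0 mulr0. Qed.

Lemma deriv_primitive {R : numFieldType} (p : {poly R}) : (primitive p)^`() = p.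
Proof.
apply/polyP => i; rewrite coef_deriv coef_poly ltnS /=.
case: ltnP => [_|le_pi]; last by rewrite mul0rn nth_default.
by rewrite -[LHS]mulr_natr divfK // pnatr_eq0.
Qed.

(** Two polynomials with the same derivative differ by a constant, by the mean
value theorem. *)
Lemma integral01_deriv {R : rcfType} (q : {poly R}) : integral01 q^`() = q.[1] - q.[0].
Proof.
pose r := q - primitive q^`().
have [c _] := poly_mvt r (@ltr01 R).
rewrite derivB deriv_primitive subrr horner0 mul0r.
rewrite /r !(hornerD, hornerN) primitive_horner0 oppr0 addr0.
by rewrite /integral01 => /eqP; rewrite subr_eq0 subr_eq => /eqP ->;
  rewrite addrAC subrr add0r.
Qed.

Lemma integral01_is_linear {R : rcfType} : linear_for *%R (@integral01 R).
Proof.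
move=> a p q.
have -> : a *: p + q = (a *: primitive p + primitive q)^`().
  by rewrite derivD derivZ !deriv_primitive.
rewrite integral01_deriv !hornerE /integral01.
by rewrite !primitive_horner0 mulr0 addr0 subr0.
Qed.

HB.instance Definition _ (R : rcfType) :=
  GRing.isLinear.Build R {poly R} R *%R (@integral01 R) integral01_is_linear.

(** Monotonicity of the integral, in the form suited to a nonnegative step: the
primitive increases on [0, r], and has slope at least [c] on [r, 1]. *)
Lemma integral01_ge {R : rcfType} (p : {poly R}) (r c : R) : 0 <= r <= 1 ->
    (forall x, 0 <= x <= r -> 0 <= p.[x]) -> (forall x, r <= x <= 1 -> c <= p.[x]) ->
  c * (1 - r) <= integral01 p.
Proof.
move=> /andP[r0 r1] p_ge0 p_gec.
rewrite -[p]deriv_primitive integral01_deriv; set P := primitive p.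
have : P.[0] <= P.[r].
  apply: (@ler_hornerW _ 0 r); rewrite ?in_itv /= ?lexx ?r0 // => x.
  by rewrite in_itv /= deriv_primitive => /andP[? ?]; apply: p_ge0; rewrite !ltW.
have : (P - c *: 'X).[r] <= (P - c *: 'X).[1].
  apply: (@ler_hornerW _ r 1); rewrite ?in_itv /= ?lexx ?r1 // => x.
  rewrite in_itv /= derivB derivZ derivX deriv_primitive => /andP[? ?].
  by rewrite !hornerE subr_ge0; apply: p_gec; rewrite !ltW.
by rewrite !hornerE; lra.
Qed.

Lemma integral01_Xn {R : rcfType} n : integral01 ('X^n : {poly R}) = n.+1%:R^-1.
Proof.
have n1 : n.+1%:R != 0 :> R by rewrite pnatr_eq0.
apply: (mulfI n1); rewrite mulfV // -linearZ /=.
rewrite (_ : _ *: _ = ('X^(n.+1))^`()); last by rewrite derivXn scaler_nat.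
rewrite integral01_deriv.
by rewrite !hornerE expr1n expr0n subr0.
Qed.

(** A half-integer Beta integral, computed by induction on [m] with integration
by parts, which lowers [m] and raises [i].  The binomial factor on the left is
the one that multiplies this integral in the integral of [latitude_mean]; the
right-hand side is then, without the powers of [a] and [b], a term of the
binomial expansion of [(a ^ 2 + b ^ 2) ^ (i + m) / (2 * (i + m) + 1)]. *)
Lemma integral01_beta {R : rcfType} i m :
  ('C((i + m).*2, m.*2) * 'C(m.*2, m))%:R / 4 ^+ m
     * integral01 ('X^(i.*2) * (1 - 'X^2) ^+ m : {poly R})
  = 'C(i + m, m)%:R / (i + m).*2.+1%:R.
Proof.
elim: m i => [|m IHm] i.
  by rewrite addn0 !bin0 expr0 mulr1 integral01_Xn muln1 divr1.
have IBP : i.*2.+1%:R * integral01 ('X^(i.*2) * (1 - 'X^2) ^+ m.+1 : {poly R})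
    = m.+1.*2%:R * integral01 ('X^(i.+1.*2) * (1 - 'X^2) ^+ m : {poly R}).
  (* This product vanishes at both ends of the interval. *)
  have := integral01_deriv ('X^(i.*2.+1) * (1 - 'X^2) ^+ m.+1 : {poly R}).
  rewrite !hornerE !expr1n subrr !expr0n /= mulr0 mul0r subrr.
  move=> ibp; apply/eqP; rewrite -subr_eq0 -!linearZ -linearB /=; apply/eqP.
  rewrite -{}ibp; congr integral01.
  rewrite derivM !deriv_exp derivB deriv_exp derivX derivC /= -!mul_polyC !polyC_natr.
  rewrite -[m.+1.*2]muln2 doubleS natrM [(1 - _) ^+ m.+1]exprS.
  rewrite ![_ ^+ (i.*2).+2]exprS ![_ ^+ (i.*2).+1]exprS.
  by move: ((1 - 'X^2) ^+ m) ('X^(i.*2)) => u v; ring.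
have n1 := mul_bin_left (i + m.+1).*2 m.*2.
have n2 := mul_bin_left (i + m.+1).*2 m.*2.+1.
have n3 := mul_bin_diag m.*2.+2 m.
have n4 := mul_bin_down (m.*2.+1) m.
have n5 := mul_bin_left (i + m.+1) m.
have e1 : ((i + m.+1).*2 - m.*2 = i.*2.+2)%N by lia.
have e2 : ((i + m.+1).*2 - m.*2.+1 = i.*2.+1)%N by lia.
have e4 : (m.*2.+1 - m = m.+1)%N by lia.
have e5 : (i + m.+1 - m = i.+1)%N by lia.
rewrite {}e1 in n1; rewrite {}e2 in n2; rewrite {}e4 /= in n4; rewrite {}e5 in n5.
have := IHm i.+1.
rewrite addSnnS !natrM => IH.
move: (congr1 (fun k : nat => k%:R : R) n1) (congr1 (fun k : nat => k%:R : R) n2)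
  (congr1 (fun k : nat => k%:R : R) n3) (congr1 (fun k : nat => k%:R : R) n4)
  (congr1 (fun k : nat => k%:R : R) n5).
rewrite !natrM => {n1 n2 n3 n4 n5} n1 n2 n3 n4 n5.
have m0 : m.+1%:R != 0 :> R by rewrite pnatr_eq0.
have m1 : m.*2.+1%:R != 0 :> R by rewrite pnatr_eq0.
have m2 : m.*2.+2%:R != 0 :> R by rewrite pnatr_eq0.
have i1 : i.*2.+1%:R != 0 :> R by rewrite pnatr_eq0.
move/(canRL (mulKf m1)): n1 => n1; move/(canRL (mulKf m2)): n2 => n2.
move/esym/(canRL (mulKf m0)): n3 => n3; move/esym/(canRL (mulKf m0)): n4 => n4.
move/(canRL (mulKf m0)): n5 => n5; move/(canRL (mulKf i1)): IBP => IBP.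
rewrite [m.+1.*2]doubleS {}n2 {}n1 {}n3 {}n4 {}n5 {}IBP.
rewrite -[RHS]mulrA -[X in _ = _ * X]mulrA -{}IH.
have p0 : 4 ^+ m != 0 :> R by rewrite expf_neq0 // pnatr_eq0.
rewrite exprS; move: (4 ^+ m) p0 => p p0.
move: (integral01 _) ('C(_, m.*2)%:R) ('C(_, m)%:R) => B a c.
move: m0 m1 m2 i1; rewrite -!doubleS -!muln2 !natrM -!(natr1) !natrM => m0 m1 m2 i1.
by field; apply/and4P; split.
Qed.

(** * Averages over the sphere *)

Lemma dotcv3 {R : realType} (u v : 'cV[R]_3) :
  dotcv u v = u 0 0 * v 0 0 + u 1 0 * v 1 0 + u 2%:R 0 * v 2%:R 0.
Proof.
rewrite /dotcv 2!big_ord_recr big_ord1 /=.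
by congr (_ * _ + _ * _ + _ * _); congr (_ _ 0); apply: val_inj.
Qed.

(** As a polynomial in [z]: the mean of [<x, u> ^ (2 * k)] when [x] runs through
the parallel of height [z] of the unit sphere. *)
Definition latitude_mean {R : realType} (u : 'cV[R]_3) (k : nat) : {poly R} :=
  \sum_(m < k.+1) ('C(k.*2, m.*2)%:R * 'C(m.*2, m)%:R / 4 ^+ m
      * u 2%:R 0 ^+ (k - m).*2 * (u 0 0 ^+ 2 + u 1 0 ^+ 2) ^+ m)
    *: ('X^((k - m).*2) * (1 - 'X^2) ^+ m).

(** The hat-box theorem for even powers: the inner product of [u] with a random
point of the sphere is uniform on [-|u|, |u|], hence the factor
[1 / (2 * k + 1)].  Integrating over [0 <= z <= 1], that is over a hemisphere,
is enough since even powers do not distinguish [x] from [-x]. *)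
Lemma integral01_latitude_mean {R : realType} (u : 'cV[R]_3) k :
  integral01 (latitude_mean u k) = dotcv u u ^+ k / k.*2.+1%:R.
Proof.
rewrite /latitude_mean linear_sum /= dotcv3 [X in _ = X ^+ k / _]addrC exprDn mulr_suml.
apply: eq_bigr => m _; rewrite linearZ /=.
have le_mk : (m <= k)%N by rewrite -ltnS.
have := @integral01_beta R (k - m) m; rewrite subnK // natrM => beta.
rewrite -2!expr2 -[_ *+ 'C(k, m)]mulr_natr -[RHS]mulrA -{}beta.
rewrite -[(k - m).*2]mul2n [u _ _ ^+ _]exprM.
by rewrite expr2; ring.
Qed.

(** The points [x z j] are the vertices of a regular polygon inscribed in the
parallel of height [z], whose radius is [sqrt (1 - z ^ 2)]. *)
Lemma latitude_design {R : realType} (d : nat) :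
  exists n (x : R -> 'I_n -> 'cV[R]_3), [/\ (0 < n)%N,
    forall z j, 0 <= z <= 1 -> dotcv (x z j) (x z j) = 1 &
    forall u k z, (k <= d)%N -> 0 <= z <= 1 ->
      \sum_j dotcv (x z j) u ^+ k.*2 = n%:R * (latitude_mean u k).[z]].
Proof.
have [n [x [y [n_gt0 xy1 mom]]]] := circle_design R d.
pose p (z : R) j : 'cV[R]_3 :=
  \col_i [:: Num.sqrt (1 - z ^+ 2) * x j; Num.sqrt (1 - z ^+ 2) * y j; z]`_i.
have s2 (z : R) : 0 <= z <= 1 -> Num.sqrt (1 - z ^+ 2) ^+ 2 = 1 - z ^+ 2.
  by move=> /andP[z0 z1]; rewrite sqr_sqrtr // subr_ge0 expr_le1.
exists n, p; split=> // [z j z01 | u k z le_kd z01].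
  rewrite dotcv3 !mxE /= -!expr2 !exprMn s2 // -mulrDr xy1; ring.
pose s := Num.sqrt (1 - z ^+ 2).
have E j : dotcv (p z j) u = z * u 2%:R 0 + (s * u 0 0 * x j + s * u 1 0 * y j).
  by rewrite dotcv3 !mxE /= -/s; ring.
under eq_bigr => j _ do rewrite E.
rewrite mom // /latitude_mean horner_sum; congr (_ * _); apply: eq_bigr => m _.
have -> : (s * u 0 0) ^+ 2 + (s * u 1 0) ^+ 2 = (1 - z ^+ 2) * (u 0 0 ^+ 2 + u 1 0 ^+ 2).
  by rewrite -s2 // -/s; ring.
by rewrite !hornerE !exprMn /=; ring.
Qed.

(** The polynomial [Q] below is the mean of [K - \sum_i g (<x, phi i> ^ 2)] over
the parallel of height [z]; it is nonnegative on [0, 1], hence so is its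
integral, which equals [K - #|I| * \int_0^1 g (t ^ 2) dt]. *)
Lemma spherical_mean_le {R : realType} (I : finType) (phi : I -> 'cV[R]_3)
    (g : {poly R}) (K : R) :
  (forall i, dotcv (phi i) (phi i) = 1) ->
  (forall x, dotcv x x = 1 -> \sum_i g.[dotcv x (phi i) ^+ 2] <= K) ->
  #|I|%:R * integral01 (g \Po 'X^2) <= K.
Proof.
move=> phi1 gK.
have [n [x [n_gt0 x1 mom]]] := @latitude_design R (size g).
pose Q := K%:P - \sum_i \sum_(k < size g) g`_k *: latitude_mean (phi i) k.
have Q_ge0 z : 0 <= z <= 1 -> 0 <= Q.[z].
  move=> z01; rewrite -(@pmulr_rge0 _ n%:R) ?ltr0n //.
  rewrite /Q !hornerE horner_sum mulrBr mulr_sumr subr_ge0.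
  have E i : n%:R * (\sum_(k < size g) g`_k *: latitude_mean (phi i) k).[z]
      = \sum_j g.[dotcv (x z j) (phi i) ^+ 2].
    rewrite horner_sum mulr_sumr; under [RHS]eq_bigr => j _ do rewrite horner_coef.
    rewrite exchange_big /=; apply: eq_bigr => k _.
    rewrite -mulr_sumr hornerZ mulrCA; congr (_ * _).
    rewrite -mom //; last exact: ltnW.
    by apply: eq_bigr => j _; rewrite -exprM mul2n.
  rewrite (eq_bigr _ (fun i _ => E i)) exchange_big /=.
  rewrite mulr_natl -[X in _ *+ X]card_ord -sumr_const.
  by apply: ler_sum => j _; apply: gK; apply: x1.
have := @integral01_ge R Q 0 0 _ _ _; rewrite mul0r lexx ler01.
have -> : integral01 Q = K - #|I|%:R * integral01 (g \Po 'X^2).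
  rewrite /Q (_ : K%:P = K *: 'X^0); last by rewrite expr0 alg_polyC.
  rewrite linearB linearZ /= integral01_Xn invr1 mulr1; congr (_ - _).
  rewrite linear_sum /= mulr_natl -sumr_const; apply: eq_bigr => i _.
  rewrite comp_polyE !linear_sum /=; apply: eq_bigr => k _.
  by rewrite !linearZ /= integral01_latitude_mean phi1 expr1n div1r -exprM mul2n
    integral01_Xn.
rewrite subr_ge0; apply => //.
  by move=> z /andP[z0 z00]; apply: Q_ge0; rewrite z0 (le_trans z00).
Qed.

(** * Polynomial approximation of a step *)

Lemma bernoulli_inequality {R : realDomainType} (y : R) n :
  -1 <= y -> 1 + n%:R * y <= (1 + y) ^+ n.
Proof.
move=> y1; elim: n => [|n IHn]; first by rewrite mul0r addr0 expr0.
have y0 : 0 <= 1 + y by lra.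
rewrite exprS; apply: le_trans (ler_wpM2l y0 IHn); rewrite -natr1.
have := mulr_ge0 (ler0n R n) (sqr_ge0 y); rewrite expr2; lra.
Qed.

(** The approximation is [1 - (1 - w ^ n) ^ K], with [K] close to [e / a ^ n].
For [w <= a] it is at most [K * w ^ n <= e]; for [w >= b] the power
[(1 - w ^ n) ^ K] is at most [1 / (K * w ^ n)], which is small for large [n]
since [(b / a) ^ n] tends to infinity. *)
Lemma step_polynomial {R : realType} (a b e : R) : 0 < a -> a < b -> 0 < e ->
  exists g : {poly R}, [/\ forall w, 0 <= w <= 1 -> 0 <= g.[w] <= 1,
    forall w, 0 <= w <= 1 -> w <= a -> g.[w] <= e &
    forall w, 0 <= w <= 1 -> b <= w -> 1 - e <= g.[w]].
Proof.
move=> a0 ab e0; have b0 : 0 < b := lt_trans a0 ab.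
pose h := b / a - 1.
have h0 : 0 < h by rewrite subr_gt0 ltr_pdivlMr // mul1r.
(* Since [K > e / a ^ n - 1] and [b <= 1] (or else no [w] satisfies [b <= w]),
   [K * b ^ n >= e * (b / a) ^ n - 1]; this has to be at least [1 / e]. *)
pose n := (Num.truncn ((1 + e^-1) / e / h)).+1.
have big_n : 1 + e^-1 <= e * (b / a) ^+ n.
  rewrite mulrC -ler_pdivrMr //.
  have -> : b / a = 1 + h by rewrite /h addrC subrK.
  apply: le_trans (bernoulli_inequality h n _); last by lra.
  apply: (@le_trans _ _ (n%:R * h)); last by rewrite lerDr.
  by rewrite -ler_pdivrMr // ltW // truncnS_gt.
pose K := Num.truncn (e / a ^+ n).
have an0 : 0 < a ^+ n by rewrite exprn_gt0.
have /andP[K1 K2] : K%:R <= e / a ^+ n < K.+1%:R.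
  by apply: truncn_itv; rewrite divr_ge0 // ltW.
have Ka : K%:R * a ^+ n <= e by rewrite -ler_pdivlMr.
exists (1 - (1 - 'X^n) ^+ K); split=> w /andP[w0 w1]; rewrite !hornerE.
- have y0 : 0 <= 1 - w ^+ n by rewrite subr_ge0 exprn_ile1.
  have y1 : 1 - w ^+ n <= 1 by rewrite gerBl exprn_ge0.
  by rewrite subr_ge0 exprn_ile1 //= gerBl exprn_ge0.
- move=> wa; have wan : w ^+ n <= a ^+ n by rewrite lerXn2r // nnegrE // ltW.
  have w1n : -1 <= - w ^+ n by rewrite lerN2 exprn_ile1.
  have := bernoulli_inequality _ K w1n; have := ler_wpM2l (ler0n R K) wan; lra.
- move=> bw; have bwn : b ^+ n <= w ^+ n by rewrite lerXn2r // nnegrE // ltW.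
  have wn1 : w ^+ n <= 1 by rewrite exprn_ile1.
  have bn0 : 0 < b ^+ n by rewrite exprn_gt0.
  have Kb : e^-1 <= K%:R * b ^+ n.
    have bn1 := le_trans bwn wn1.
    move: big_n; rewrite expr_div_n mulrCA.
    have := ler_pM2r bn0 (e / a ^+ n) K.+1%:R; rewrite (ltW K2) -natr1 => H.
    move: H; lra.
  have Kw : 1 <= e * (K%:R * w ^+ n).
    rewrite -ler_pdivrMl // mulr1; apply: le_trans Kb _.
    by rewrite ler_wpM2l.
  have u0 : 0 <= (1 - w ^+ n) ^+ K by rewrite exprn_ge0 // subr_ge0.
  have y1 : (1 - w ^+ n) ^+ K * (1 + w ^+ n) ^+ K <= 1.
    rewrite -exprMn -subr_sqr expr1n exprn_ile1 // ?subr_ge0 ?gerBl ?sqr_ge0 //.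
    by rewrite expr_le1 ?exprn_ge0.
  have w1n : -1 <= w ^+ n by rewrite (@le_trans _ _ 0) ?exprn_ge0 //; lra.
  have := bernoulli_inequality _ K w1n => bern.
  have : (1 - w ^+ n) ^+ K * (K%:R * w ^+ n) <= 1.
    apply: le_trans y1; rewrite ler_wpM2l //; lra.
  nra.
Qed.

(** * Disjointness of the caps and the packing bound *)

Lemma dotcvC {R : realType} m (u v : 'cV[R]_m) : dotcv u v = dotcv v u.
Proof. by apply: eq_bigr => k _; rewrite mulrC. Qed.

Lemma dotcvDl {R : realType} m (u v w : 'cV[R]_m) :
  dotcv (u + v) w = dotcv u w + dotcv v w.
Proof. by rewrite -big_split; apply: eq_bigr => k _; rewrite mxE mulrDl. Qed.

Lemma dotcvZl {R : realType} m (a : R) (u w : 'cV[R]_m) :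
  dotcv (a *: u) w = a * dotcv u w.
Proof. by rewrite mulr_sumr; apply: eq_bigr => k _; rewrite mxE mulrA. Qed.

Lemma dotcv_ge0 {R : realType} m (u : 'cV[R]_m) : 0 <= dotcv u u.
Proof. by apply: sumr_ge0 => k _; rewrite -expr2 sqr_ge0. Qed.

Lemma dotcvDD {R : realType} m (a : R) (u v : 'cV[R]_m) :
  dotcv (u + a *: v) (u + a *: v) = dotcv u u + 2 * a * dotcv u v + a ^+ 2 * dotcv v v.
Proof.
rewrite dotcvDl dotcvZl (dotcvC _ u) (dotcvC _ v) !dotcvDl !dotcvZl (dotcvC _ v u); ring.
Qed.

(** Cauchy-Schwarz: the component of [u] orthogonal to [x] has a nonnegative
squared norm. *)
Lemma dotcv_unit_le {R : realType} m (x u : 'cV[R]_m) :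
  dotcv x x = 1 -> dotcv x u ^+ 2 <= dotcv u u.
Proof.
move=> x1; have := dotcv_ge0 _ (u + (- dotcv x u) *: x).
by rewrite dotcvDD x1 (dotcvC _ u x); lra.
Qed.

(** By Cauchy-Schwarz, [(<x, u> + a * <x, v>) ^ 2 <= |u + a * v| ^ 2 <= 2 + 2 * mu]
for both signs [a].  If both squared inner products exceeded [(1 + mu) / 2], then for
the sign [a] of [<x, u> * <x, v>] the left-hand side would exceed [2 + 2 * mu]. *)
Lemma caps_disjoint {R : realType} m (x u v : 'cV[R]_m) (mu : R) :
    dotcv x x = 1 -> dotcv u u = 1 -> dotcv v v = 1 -> `|dotcv u v| <= mu ->
  (1 + mu) / 2 < dotcv x u ^+ 2 -> dotcv x v ^+ 2 <= (1 + mu) / 2.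
Proof.
move=> x1 u1 v1; rewrite ler_norml => /andP[uv1 uv2] xu; rewrite leNgt; apply/negP => xv.
have CS (a : R) : a ^+ 2 = 1 ->
    (dotcv x u + a * dotcv x v) ^+ 2 <= 2 + 2 * a * dotcv u v.
  move=> a1; have := dotcv_unit_le _ x (u + a *: v) x1.
  by rewrite dotcvDD u1 v1 a1 dotcvC dotcvDl dotcvZl !(dotcvC _ _ x); lra.
have := CS 1 (expr1n _ _); have := CS (-1) (etrans (sqrrN 1) (expr1n _ _)).
have mu0 : 0 <= (1 + mu) / 2 by lra.
move: (dotcv x u) (dotcv x v) (dotcv u v) uv1 uv2 xu xv => a b p uv1 uv2 xu xv Cm Cp.
have ab2 : ((1 + mu) / 2) ^+ 2 < (a * b) ^+ 2.
  by rewrite [ltLHS]expr2 [ltRHS]exprMn; apply: ltr_pM.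
have ab : (1 + mu) / 2 < `|a * b|.
  by rewrite -(@ltr_pXn2r _ 2) ?nnegrE ?normr_ge0 // real_normK ?num_real.
move: ab; case: ger0P => _ ab; nra.
Qed.

Lemma unit_norm_frame_dim {R : realType} m N (Phi : 'M[R]_(m, N)) :
  unit_norm_frame Phi -> (m <= N)%N.
Proof. by case=> rk _; rewrite -[leqLHS]rk rank_leq_col. Qed.

Lemma dotcv_le_coherence {R : realType} m N (Phi : 'M[R]_(m, N)) i j :
  i != j -> `|dotcv (col i Phi) (col j Phi)| <= coherence Phi.
Proof. by move=> ij; apply: (le_bigmax_cond _ _ (j := (i, j))). Qed.

Lemma coherence_ge0 {R : realType} m N (Phi : 'M[R]_(m, N)) : 0 <= coherence Phi.
Proof. exact: bigmax_ge_id. Qed.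

(** The caps of height [1 - c] are disjoint, so at each point of the sphere at
most one term [g (<x, phi i> ^ 2)] exceeds [e]; the sum of all of them is
at most [1 + N * e], while the integral of [g (t ^ 2)] is at least
[(1 - e) * (1 - r)].  The height [r > c] leaves room for the step to rise. *)
Lemma cap_packing {R : realType} N (phi : 'I_N -> 'cV[R]_3) (mu c r : R) :
    (forall i, dotcv (phi i) (phi i) = 1) ->
    (forall i j, i != j -> `|dotcv (phi i) (phi j)| <= mu) ->
    0 < c -> c ^+ 2 = (1 + mu) / 2 -> c < r -> r <= 1 ->
  N%:R * (1 - r) <= 1.
Proof.
move=> phi1 phi_mu c0 c2 cr r1.
have r0 : 0 < r := lt_trans c0 cr.
have main e : 0 < e -> N%:R * ((1 - e) * (1 - r)) <= 1 + N%:R * e.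
  move=> e0.
  have c2r2 : c ^+ 2 < r ^+ 2 by rewrite ltr_pXn2r ?nnegrE ?ltW.
  have [g [g01 g_small g_large]] := step_polynomial _ _ _ (exprn_gt0 2 c0) c2r2 e0.
  have sq01 (t : R) : 0 <= t <= 1 -> 0 <= t ^+ 2 <= 1.
    by move=> /andP[t0 t1]; rewrite exprn_ge0 ?exprn_ile1.
  have int_g : (1 - e) * (1 - r) <= integral01 (g \Po 'X^2).
    apply: integral01_ge; first by rewrite ltW.
      move=> t /andP[t0 tr]; rewrite horner_comp hornerXn.
      have /andP[-> _] // : 0 <= g.[t ^+ 2] <= 1.
      by apply: g01; rewrite sq01 // t0 (le_trans tr).
    move=> t /andP[rt t1]; rewrite horner_comp hornerXn.
    have t0 : 0 <= t by rewrite (le_trans _ rt) ?ltW.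
    apply: g_large; first by rewrite sq01 // t0.
    by rewrite lerXn2r // nnegrE ltW.
  apply: le_trans (ler_wpM2l (ler0n R N) int_g) _.
  have := @spherical_mean_le R 'I_N phi g (1 + N%:R * e) phi1; rewrite card_ord; apply.
  move=> x x1.
  have sq i : 0 <= dotcv x (phi i) ^+ 2 <= 1.
    by rewrite sqr_ge0 -(phi1 i) dotcv_unit_le.
  have e_sum (P : pred 'I_N) : \sum_(i | P i) e <= N%:R * e.
    rewrite sumr_const -[leLHS]mulr_natl.
    apply: ler_wpM2r (ltW e0) _ _ _; rewrite ler_nat.
    by rewrite -[leqRHS]card_ord max_card.
  have [[i far]|near] := pselect (exists i, c ^+ 2 < dotcv x (phi i) ^+ 2).
    rewrite (bigD1 i) //= lerD //; first by case/andP: (g01 _ (sq i)).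
    apply: le_trans (e_sum (fun j => j != i)); apply: ler_sum => j ji.
    apply: g_small => //; rewrite c2; apply: (caps_disjoint _ x (phi i)) => //.
      by apply: phi_mu; rewrite eq_sym.
    by rewrite -c2.
  apply: (@le_trans _ _ (N%:R * e)); last by rewrite lerDr.
  apply: le_trans (e_sum predT); apply: ler_sum => j _; apply: g_small => //.
  by rewrite leNgt; apply/negP => H; apply: near; exists j.
rewrite leNgt; apply/negP => gt1.
have N0 : 0 <= N%:R :> R := ler0n R N.
(* At this [e], the inequality [main] fails. *)
pose e := (N%:R * (1 - r) - 1) / (4 * (N%:R + 1)).
have eE : e * (4 * (N%:R + 1)) = N%:R * (1 - r) - 1 by rewrite /e divfK //; lra.
have e0 : 0 < e by rewrite divr_gt0; lra.
have := main e e0.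
move: (N%:R) N0 gt1 eE => n; nra.
Qed.

Theorem theorem66 (R : realType) (N : nat) (Phi : 'M[R]_(3, N))
  (hPhi : unit_norm_frame Phi) :
  coherence Phi >= 1 - 4 / N%:R + 2 / N%:R ^+ 2.
Proof.
have N3 := unit_norm_frame_dim _ _ _ hPhi.
have phi1 i : dotcv (col i Phi) (col i Phi) = 1.
  by have := congr1 (fun t => t ^+ 2) (hPhi.2 i);
    rewrite /= sqr_sqrtr ?dotcv_ge0 // expr1n.
have mu_ge0 := coherence_ge0 _ _ Phi; set mu := coherence Phi in mu_ge0 *.
pose q : R := N%:R^-1.
have [q0 q1] : 0 < q /\ q <= 1 / 3.
  have n0 : (0 < N)%N by rewrite (leq_trans _ N3).
  by rewrite invr_gt0 ltr0n n0 div1r lef_pV2 ?posrE ?ltr0n // ler_nat.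
have -> : 1 - 4 / N%:R + 2 / N%:R ^+ 2 = 2 * (1 - q) ^+ 2 - 1.
  by rewrite -exprVn -/q; ring.
rewrite leNgt; apply/negP => mu_lt.
pose c := Num.sqrt ((1 + mu) / 2).
have c2 : c ^+ 2 = (1 + mu) / 2 by rewrite sqr_sqrtr //; lra.
have c0 : 0 < c by rewrite sqrtr_gt0; lra.
have cq : c < 1 - q.
  rewrite -(@ltr_pXn2r _ 2) ?nnegrE ?ltW //; lra.
(* Any [r] strictly between [c] and [1 - 1 / N] contradicts the packing bound. *)
pose r := (c + (1 - q)) / 2.
have pack : N%:R * (1 - r) <= 1.
  apply: (cap_packing N (fun i => col i Phi) mu c) => //; rewrite /r; [|lra|lra].
  by move=> i j ij; apply: dotcv_le_coherence.
rewrite -[N%:R]invrK ler_pdivrMl // mulr1 -/q in pack.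
by rewrite /r in pack; lra.
Qed.
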